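(* Fix $\alpha\in\Theta$. The influence function at $P_{\theta_0}$ of the functional $T_\alpha(P)=\arg\sup_{\theta\in\Theta}\int m(\theta,\alpha,y)\,dP(y)$ (the functional corresponding to the dual $\phi$-divergence estimator $\widehat\theta_n(\alpha)$) is given by $$\mathrm{IF}(x;T_\alpha,P_{\theta_0})=\left[\int m''(\theta_0,\alpha)\,dP_{\theta_0}\right]^{-1}\left\{\int \varphi''\left(\frac{p_\alpha}{p_{\theta_0}}\right)\frac{p_\alpha}{p_{\theta_0}^2}\,\dot p_{\theta_0}\,dP_\alpha-\varphi''\left(\frac{p_\alpha(x)}{p_{\theta_0}(x)}\right)\frac{p_\alpha^2(x)}{p_{\theta_0}^3(x)}\,\dot p_{\theta_0}(x)\right\}.$$
   Context: Setting: $\varphi:(0,\infty)\to[0,\infty]$ is a non-negative, strictly convex, differentiable function (with second derivative $\varphi''$) with $\varphi(1)=0$, extended by $\varphi(0)=\lim_{x\downarrow 0}\varphi(x)$. $\{P_\theta:\theta\in\Theta\}$, $\Theta\subset\mathbb R^d$, is an identifiable parametric model on a measurable space $(\mathcal X,\mathcal B)$; each $P_\theta$ has density $p_\theta$ with respect to a dominating $\sigma$-finite measure $\lambda$; $\theta_0\in\Theta$ is the true parameter value; $\dot p_\theta$ is the (column vector) derivative of $p_\theta$ with respect to $\theta$. Put $\phi(\alpha,\theta)=\int\varphi(p_\alpha/p_\theta)\,dP_\theta$ and $$m(\theta,\alpha,x)=\int\varphi'\left(\frac{p_\alpha}{p_\theta}\right)dP_\alpha-\left\{\varphi'\left(\frac{p_\alpha(x)}{p_\theta(x)}\right)\frac{p_\alpha(x)}{p_\theta(x)}-\varphi\left(\frac{p_\alpha(x)}{p_\theta(x)}\right)\right\},$$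 so that (dual representation) $\phi(\alpha,\theta_0)=\sup_{\theta\in\Theta}\int m(\theta,\alpha)\,dP_{\theta_0}$, the supremum being uniquely attained at $\theta=\theta_0$ for every $\alpha$. The dual $\phi$-divergence estimator based on an i.i.d. sample with empirical measure $P_n$ is $\widehat\theta_n(\alpha)=\arg\sup_{\theta\in\Theta}\int m(\theta,\alpha)\,dP_n=T_\alpha(P_n)$. $m'(\theta,\alpha)$ and $m''(\theta,\alpha)$ denote the gradient (column vector) and Hessian matrix of $m$ with respect to $\theta$. Standing assumptions: for each $\alpha$, $\theta\mapsto m(\theta,\alpha)$ is twice continuously differentiable; the matrix $\int m''(\theta_0,\alpha)\,dP_{\theta_0}$ exists and is invertible; and all partial derivatives of order 1 and 2 of $\theta\mapsto m(\theta,\alpha)$ are dominated on some neighborhoods of $\theta_0$ by $P_{\theta_0}$-integrable functions (which justifies interchanging differentiation in $\theta$ and integration). The influence function of a statistical functional $T$ at $P$ is $\mathrm{IF}(x;T,P)=\lim_{\varepsilon\to0}\frac{T(\widetilde P_{\varepsilon x})-T(P)}{\varepsilon}$, where $\widetilde P_{\varepsilon x}=(1-\varepsilon)P+\varepsilon\delta_x$ and $\delta_x$ is the Dirac measure at $x$.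
   Formalization: Added: the arg sup is attained at contaminated laws for small ε>0 and T_α(P_ε)→T_α(P_θ0) as ε↓0 (without this the limit may not exist); all p_θ share the support of p_θ0, which contains x; the limit in ε is one-sided. *)

(* Defs.v *)
From HB Require Import structures.
From mathcomp Require Import all_boot all_order all_algebra.
From mathcomp Require Import all_classical all_reals all_analysis.

Set Implicit Arguments.
Unset Strict Implicit.
Unset Printing Implicit Defensive.

Import Order.TTheory GRing.Theory Num.Theory.
Import numFieldNormedType.Exports.

Local Open Scope classical_set_scope.
Local Open Scope ring_scope.

(* Vectors of R^d, d >= 1, are columns 'cV[R]_d.+1. *)

Section Calculus.
Context {R : realType} {d : nat}.
Implicit Types (f : 'cV[R]_d.+1 -> R) (t : 'cV[R]_d.+1) (U : set 'cV[R]_d.+1).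

Definition ei (i : 'I_d.+1) : 'cV[R]_d.+1 := delta_mx i 0.

Definition partial (i : 'I_d.+1) f : 'cV[R]_d.+1 -> R :=
  fun t => 'D_(ei i) f t.

Definition gradient f t : 'cV[R]_d.+1 := \col_i partial i f t.

Definition hessian f t : 'M[R]_d.+1 :=
  \matrix_(i, j) partial j (partial i f) t.

Definition C2_on U f :=
  forall t, U t ->
    [/\ {for t, continuous f},
        forall i, derivable f t (ei i) /\ {for t, continuous (partial i f)} &
        forall i j, derivable (partial i f) t (ei j) /\
                    {for t, continuous (partial j (partial i f))}].

End Calculus.

Definition integral_mx {disp} {X : measurableType disp} {R : realType}
    (mu : {measure set X -> \bar R}) {k l : nat} (F : X -> 'M[R]_(k, l)) :
    'M[R]_(k, l) :=
  \matrix_(i, j) \int[mu]_x (F x i j).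

Definition integrable_mx {disp} {X : measurableType disp} {R : realType}
    (mu : {measure set X -> \bar R}) {k l : nat} (F : X -> 'M[R]_(k, l)) :=
  forall i j, mu.-integrable setT (fun x => (F x i j)%:E).

Section Divergence.
Context {R : realType}.
Implicit Type phi : R -> R.

(* Only the values of phi on ]0, +oo[ are meaningful. *)
Record divergence_generator phi : Prop := {
  dg_ge0 : forall u, 0 < u -> 0 <= phi u ;
  dg_strictly_convex : forall u v s, 0 < u -> 0 < v -> u != v -> 0 < s < 1 ->
    phi (s * u + (1 - s) * v) < s * phi u + (1 - s) * phi v ;
  dg_derivable : forall u, 0 < u -> derivable phi u 1 ;
  dg_derivable2 : forall u, 0 < u -> derivable (derive1 phi) u 1 ;
  dg_eq0 : phi 1 = 0 }.

(* phi(0) is the limit of phi at 0+, which may be +oo. *)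
Definition phi_ext phi (u : R) : \bar R :=
  if u == 0 then lim ((phi v)%:E @[v --> 0^'+]) else (phi u)%:E.

End Divergence.

Section Model.
Context {disp : measure_display} {X : measurableType disp} {R : realType}.
Context {d : nat}.
Implicit Types (Theta : set 'cV[R]_d.+1) (P : 'cV[R]_d.+1 -> probability X R).
Implicit Types (p : 'cV[R]_d.+1 -> X -> R) (theta alpha : 'cV[R]_d.+1).

Definition identifiable Theta P :=
  forall t t', Theta t -> Theta t' ->
    (forall A, measurable A -> P t A = P t' A) -> t = t'.

Definition is_density (lambda : {measure set X -> \bar R})
    (Q : probability X R) (q : X -> R) :=
  [/\ measurable_fun setT q, forall y, 0 <= q y &
      forall A, measurable A -> Q A = (\int[lambda]_(y in A) (q y)%:E)%E].

(* Where p theta y = 0 the quotient reads 0; this set is P_theta-null. *)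
Definition phi_divergence (phi : R -> R) P p alpha theta : \bar R :=
  (\int[P theta]_y phi_ext phi (p alpha y / p theta y))%E.

(* theta is the escort parameter, the one differentiated and optimized over;
   the formula is meaningful where p alpha and p theta are positive. *)
Definition dual_m (phi : R -> R) P p theta alpha (x : X) : R :=
  \int[P alpha]_y (derive1 phi (p alpha y / p theta y))
  - (derive1 phi (p alpha x / p theta x) * (p alpha x / p theta x)
     - phi (p alpha x / p theta x)).

(* The criterion is integrated in \bar R, so that its value may be infinite. *)
Definition criterion (m : 'cV[R]_d.+1 -> X -> R) (Q : probability X R) theta :
    \bar R :=
  (\int[Q]_y (m theta y)%:E)%E.

Definition argsup Theta (m : 'cV[R]_d.+1 -> X -> R) (Q : probability X R) :
    set 'cV[R]_d.+1 :=
  [set t | Theta t /\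
           criterion m Q t = ereal_sup [set criterion m Q t' | t' in Theta]].

(* T Q is unconstrained when the supremum is not attained, and is one of the
   maximizers when there are several. *)
Definition argsup_functional Theta (m : 'cV[R]_d.+1 -> X -> R)
    (T : probability X R -> 'cV[R]_d.+1) :=
  forall Q, argsup Theta m Q !=set0 -> argsup Theta m Q (T Q).

End Model.

(* (1 - e) Q + e delta_x; the value Q outside 0 <= e <= 1 only serves to make
   this a total function of e into probability measures. *)
Definition contamination {disp} {X : measurableType disp} {R : realType}
    (Q : probability X R) (x : X) (e : R) : set X -> \bar R :=
  fun A => if 0 <= e <= 1 then ((1 - e)%:E * Q A + e%:E * \d_x A)%E else Q A.

Section Contamination.
Context {disp : measure_display} {X : measurableType disp} {R : realType}.
Variables (Q : probability X R) (x : X) (e : R).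

Let contamination0 : contamination Q x e set0 = 0%E.
Proof. by rewrite /contamination; case: ifPn; rewrite ?measure0 ?mule0 ?adde0. Qed.

Let contamination_ge0 A : (0 <= contamination Q x e A)%E.
Proof.
rewrite /contamination; case: ifPn => // /andP[e0 e1].
by rewrite adde_ge0 // mule_ge0 // lee_fin // subr_ge0.
Qed.

Let contamination_sigma_additive : semi_sigma_additive (contamination Q x e).
Proof.
have [/andP[e0 e1]|e01] := boolP (0 <= e <= 1); last first.
  suff -> : contamination Q x e = Q by exact: measure_semi_sigma_additive.
  by apply/funext => A; rewrite /contamination (negbTE e01).
have e1' : 0 <= 1 - e by rewrite subr_ge0.
suff -> : contamination Q x e =
    measure_add (mscale (NngNum e1') Q) (mscale (NngNum e0) \d_x).
  exact: measure_semi_sigma_additive.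
by apply/funext => A; rewrite measure_addE /contamination e0 e1.
Qed.

HB.instance Definition _ := isMeasure.Build _ _ _ (contamination Q x e)
  contamination0 contamination_ge0 contamination_sigma_additive.

Let contamination_setT : contamination Q x e setT = 1%E.
Proof.
rewrite /contamination; case: ifPn => _; last exact: probability_setT.
by rewrite probability_setT diracT !mule1 -EFinD subrK.
Qed.

HB.instance Definition _ :=
  @Measure_isProbability.Build _ _ R (contamination Q x e) contamination_setT.

End Contamination.

(* The limit is one-sided: (1 - e) Q + e delta_x is in general not a
   probability measure for e < 0. *)
Definition is_influence_function {disp} {X : measurableType disp}
    {R : realType} {d : nat} (T : probability X R -> 'cV[R]_d.+1)
    (Q : probability X R) (x : X) (v : 'cV[R]_d.+1) :=
  e^-1 *: (T (contamination Q x e) - T Q) @[e --> 0^'+] --> v.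

(* Main.v *)
Require Import Defs.
From HB Require Import structures.
From mathcomp Require Import all_boot all_order all_algebra.
From mathcomp Require Import all_classical all_reals all_analysis.
From mathcomp Require Import measurable_realfun ring lra.

Import Order.TTheory GRing.Theory Num.Theory.
Import numFieldNormedType.Exports.

Local Open Scope classical_set_scope.
Local Open Scope ring_scope.

Set Implicit Arguments.
Unset Strict Implicit.
Unset Printing Implicit Defensive.

(** Write Q for the true distribution P theta0, M for the function
    theta |-> int m(theta, y) dQ(y), and theta_e for a maximizer of the
    contaminated criterion (1 - e) M(theta) + e m(theta, x).

    Near theta0 the increments of m and of its gradient are dominated by an
    integrable function, so that M is finite there (an infinite value at theta0
    would propagate to its neighbours and contradict the uniqueness of the
    maximizer) and its gradient is int m'(theta, y) dQ(y).  An interior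
    maximum is a critical point, whence int m'(theta0) dQ = 0 and
      (1 - e) int m'(theta_e) dQ + e m'(theta_e, x) = 0.
    The difference int m'(theta_e) dQ - int m'(theta0) dQ is
    A_e (theta_e - theta0) for a matrix A_e of integrated difference quotients,
    and A_e tends to J = int m''(theta0) dQ by dominated convergence.  Hence
    w_e = (theta_e - theta0) / e solves A_e w_e = - m'(theta_e, x) / (1 - e),
    and Cramer's rule gives w_e --> - J^-1 m'(theta0, x): this is
    [influence_function_argsup], which holds for any such m.

    For the dual criterion, m(theta, y) is c(theta) minus a function of
    p_alpha(y) / p_theta(y), where c(theta) does not depend on y.  Only the
    second part is differentiated by hand; it contributes
    psi(y) = phi''(r) p_alpha^2 / p_theta0^3 pdot(y) with
    r = p_alpha(y) / p_theta0(y), so that m'(theta0, y) = c' + psi(y) for a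
    constant vector c' ([partial_dual_m]).  Since the integral of m'(theta0)
    under Q is 0, c' = - int psi dQ, and the change of measure
    dP_alpha = (p_alpha / p_theta0) dQ turns this integral into the one of the
    statement.  The derivative of c is thus obtained without differentiating
    under the integral that defines c. *)

(** * Secants of functions of several variables *)

Section Secants.
Context {R : realType} {d : nat}.
Implicit Types (f : 'cV[R]_d.+1 -> R) (t s : 'cV[R]_d.+1).

Lemma is_derive_line f t v (h l : R) :
  is_derive h 1 (fun u : R => f (t + u *: v)) l <->
  is_derive (t + h *: v) v f l.
Proof.
have E : (fun k : R => k^-1 *: (f (k *: v + (t + h *: v)) - f (t + h *: v))) =
    (fun k : R => k^-1 *: (f (t + (k *: (1 : R) + h) *: v) - f (t + h *: v))).
  apply/funext => k; do 3 f_equal.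
  by rewrite [k *: (1 : R)]mulr1 scalerDl addrCA.
split=> -[df dl].
  by split; [rewrite /derivable E|rewrite -dl /derive E].
by split; [rewrite /derivable -E|rewrite -dl /derive -E].
Qed.

(** The polygonal path from t to s that changes one coordinate at a time. *)
Definition path_point t s (k : nat) : 'cV[R]_d.+1 :=
  \col_i (if (i < k)%N then s i 0 else t i 0).

(** The difference quotient of f along the k-th edge of the path from t to s.
    On a degenerate edge it is completed by the partial derivative at t, which
    is the limit of the secants as s tends to t. *)
Definition secant (k : 'I_d.+1) f t s : R :=
  if s k 0 == t k 0 then partial k f t
  else (f (path_point t s k.+1) - f (path_point t s k)) / (s k 0 - t k 0).

Lemma path_pointS t s (k : 'I_d.+1) :
  path_point t s k.+1 = path_point t s k + (s k 0 - t k 0) *: ei k.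
Proof.
apply/colP => i; rewrite !mxE eqxx andbT ltnS leq_eqVlt.
have [->|ik] := eqVneq i k; first by rewrite eqxx ltnn mulr1 addrC subrK.
by rewrite val_eqE (negbTE ik)/= mulr0 addr0.
Qed.

Lemma ball_path_point t s (e : R) k : ball t e s -> ball t e (path_point t s k).
Proof.
move=> [e0 ts]; split=> // i j; rewrite ord1 mxE.
by case: ifP => _; [exact: ts|exact: ballxx].
Qed.

(** An increment of f is linear in s - t with the secants as coefficients:
    this replaces the differential of f, and survives integration of f with
    respect to a parameter. *)
Lemma sum_secant f t s :
  f s - f t = \sum_(k < d.+1) secant k f t s * (s k 0 - t k 0).
Proof.
have -> : f s - f t = f (path_point t s d.+1) - f (path_point t s 0).
  by congr (f _ - f _); apply/colP => i; rewrite mxE ?ltn_ord.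
rewrite -(telescope_sumr (fun k => f (path_point t s k)))//.
rewrite big_mkord; apply: eq_bigr => k _.
rewrite /secant; case: eqP => [st|/eqP st].
  by rewrite path_pointS st subrr scale0r addr0 subrr mulr0.
by rewrite divfK// subr_eq0.
Qed.

Lemma mean_value_sym (g dg : R -> R) (a : R) :
  (forall h : R, `|h| <= `|a| -> is_derive h 1 g (dg h)) ->
  exists2 c, `|c| <= `|a| & g a - g 0 = dg c * a.
Proof.
move=> gdg; have [a0|a0] := leP 0 a.
  have [||c /[!in_itv]/= /andP[c0 ca] E] := @MVT_segment R g dg 0 a a0.
  - move=> h /[!in_itv]/= /andP[h0 ha]; apply: gdg.
    by rewrite !ger0_norm// ltW.
  - apply: derivable_within_continuous => h /[!in_itv]/= /andP[h0 ha].
    by have [] : is_derive h 1 g (dg h) by apply: gdg; rewrite !ger0_norm.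
  by exists c; rewrite ?ger0_norm// E subr0.
have [||c /[!in_itv]/= /andP[ca c0] E] := @MVT_segment R g dg a 0 (ltW a0).
- move=> h /[!in_itv]/= /andP[ha h0]; apply: gdg.
  by rewrite !ltr0_norm// lerN2 ltW.
- apply: derivable_within_continuous => h /[!in_itv]/= /andP[ha h0].
  have [] // : is_derive h 1 g (dg h).
  by apply: gdg; rewrite !ler0_norm ?lerN2 ?(ltW a0).
exists c; first by rewrite !ler0_norm ?lerN2 ?(ltW a0).
by rewrite -opprB E sub0r mulrN opprK.
Qed.

(** The balls of 'cV[R]_d.+1 are boxes, hence they contain the whole path from
    their centre to any of their points. *)
Lemma secant_mean_value (k : 'I_d.+1) f t s (e : R) :
  (forall u, ball t e u -> derivable f u (ei k)) -> ball t e s ->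
  exists2 u, ball t e u & secant k f t s = partial k f u.
Proof.
move=> df ts; have e0 : 0 < e by case: ts.
rewrite /secant; case: eqP => [_|/eqP st].
  by exists t => //; exact: ballxx.
pose a := s k 0 - t k 0; pose z := path_point t s k.
have inb h : `|h| <= `|a| -> ball t e (z + h *: ei k).
  move=> ha; split=> // i j; rewrite ord1 !mxE eqxx andbT /ball/=.
  have [->|ik] := eqVneq i k.
    rewrite ltnn mulr1 opprD addrA subrr sub0r normrN (le_lt_trans ha)//.
    by rewrite /a distrC; case: ts => _ /(_ k 0).
  rewrite mulr0 addr0; case: ifPn => _; last by rewrite subrr normr0.
  by case: ts => _ /(_ i 0).
have line (h : R) : `|h| <= `|a| -> is_derive h 1
    (fun h : R => f (z + h *: ei k)) ('D_(ei k) f (z + h *: ei k)).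
  by move=> /inb zh; apply/is_derive_line/derivableP; exact: df.
have [h ha E] := mean_value_sym line.
exists (z + h *: ei k); first exact: inb.
move: E; rewrite scale0r addr0 path_pointS -/a -/z => ->.
by rewrite mulfK// subr_eq0.
Qed.

Lemma ball_line t k (e h : R) : `|h| < e -> ball t e (t + h *: ei k).
Proof.
move=> he; split; first exact: le_lt_trans (normr_ge0 h) he.
move=> i j; rewrite !mxE /ball/= opprD addrA subrr sub0r normrN.
rewrite normrM; apply: le_lt_trans he; apply: ler_piMr => //.
by case: (_ && _); rewrite ?normr0 ?normr1.
Qed.

Lemma cvg_line (u : R^nat) t k :
  u @ \oo --> (0 : R) -> (fun n => t + u n *: ei k) @ \oo --> t.
Proof.
move=> u0; apply/cvg_ballP => e e0; near=> n; apply: ball_line.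
by near: n; exact: cvgr0_norm_lt.
Unshelve. all: by end_near. Qed.

Lemma cvg_partial f t k (u : R^nat) :
  derivable f t (ei k) -> (forall n, u n != 0) -> u @ \oo --> (0 : R) ->
  (fun n => (u n)^-1 * (f (t + u n *: ei k) - f t)) @ \oo --> partial k f t.
Proof.
move=> df un0 u0; move/cvgr_dnbhsP : (df) => /(_ u (conj un0 u0)) /=.
by under eq_fun do rewrite [_ *: _ + t]addrC.
Qed.

Lemma exists_null_sequence (e : R) : 0 < e ->
  exists u : R^nat,
    [/\ forall n, 0 < u n, forall n, `|u n| < e & u @ \oo --> (0 : R)].
Proof.
move=> e0; exists (fun n => e / 2 / n.+1%:R).
have u_gt0 n : 0 < e / 2 / n.+1%:R by rewrite !divr_gt0.
split=> // [n|].
  rewrite gtr0_norm// ltr_pdivrMr//.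
  have : (1 : R) <= n.+1%:R by rewrite ler1n.
  by nra.
rewrite -(mulr0 (e / 2)); apply: cvgM; first exact: cvg_cst.
exact: cvg_harmonic.
Qed.

End Secants.

(** * Differentiation under the integral sign *)

Section UnderIntegral.
Context {disp : measure_display} {X : measurableType disp} {R : realType}.
Context {d : nat} (mu : {measure set X -> \bar R}) (D : set X).
Hypothesis mD : measurable D.
Implicit Types (f : 'cV[R]_d.+1 -> X -> R) (t s : 'cV[R]_d.+1).

(** Only the increments of f are controlled, not f itself: the record also
    serves to prove that f is integrable. *)
Record dominated_C1 f t (e : R) (g : X -> R) : Prop := DominatedC1 {
  dc_measurable : forall u, ball t e u -> measurable_fun D (f u) ;
  dc_derivable : forall u y k, ball t e u -> D y ->
    derivable (f ^~ y) u (ei k) ;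
  dc_continuous : forall u y k, ball t e u -> D y ->
    {for u, continuous (partial k (f ^~ y))} ;
  dc_bound : forall u y k, ball t e u -> D y ->
    `|partial k (f ^~ y) u| <= g y ;
  dc_integrable : mu.-integrable D (EFin \o g) }.

Lemma dominated_C1_sub f t e g u : dominated_C1 f t e g -> ball t e u ->
  exists2 e', 0 < e' & dominated_C1 f u e' g /\ ball u e' `<=` ball t e.
Proof.
move=> fC1 tu.
have [e' e'0 ue'] : exists2 e' : R, 0 < e' & ball u e' `<=` ball t e.
  have : nbhs u (ball t e : set 'cV[R]_d.+1).
    by apply: open_nbhs_nbhs; split=> //; apply: ball_open; case: tu.
  by move=> /nbhs_ballP.
exists e' => //; split=> //; split.
- by move=> v /ue'; exact: dc_measurable fC1 _.
- by move=> v y k /ue'; exact: (dc_derivable fC1).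
- by move=> v y k /ue'; exact: (dc_continuous fC1).
- by move=> v y k /ue'; exact: (dc_bound fC1).
- exact: dc_integrable fC1.
Qed.

Lemma measurable_partial f t e g k : 0 < e ->
  dominated_C1 f t e g -> measurable_fun D (fun y => partial k (f ^~ y) t).
Proof.
move=> e0 fC1; have [u [u_gt0 ue u0]] := exists_null_sequence e0.
apply: (@measurable_fun_cvg _ _ _ _
  (fun n y => (u n)^-1 * (f (t + u n *: ei k) y - f t y))); last first.
  move=> y Dy; apply: (@cvg_partial _ _ (f ^~ y)) => //.
    by apply: (dc_derivable fC1) => //; exact: ballxx.
  by move=> n; rewrite gt_eqF.
move=> n; apply: measurable_funM; first exact: measurable_cst.
apply: measurable_funB; apply: (dc_measurable fC1); last exact: ballxx.
exact: ball_line.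
Qed.

Lemma Rintegral_sum (I : finType) (h : I -> X -> R) :
  (forall i, mu.-integrable D (EFin \o h i)) ->
  \int[mu]_(y in D) (\sum_i h i y) = \sum_i \int[mu]_(y in D) h i y.
Proof.
move=> ih; rewrite /Rintegral; under eq_integral do rewrite -sumEFin.
rewrite (integral_sum mD ih) -sum_fine// => i _.
exact: integrable_fin_num.
Qed.

Section Secant.
Variables (f : 'cV[R]_d.+1 -> X -> R) (t : 'cV[R]_d.+1) (e : R) (g : X -> R).
Hypothesis fC1 : dominated_C1 f t e g.

Lemma secant_bound s y k : ball t e s -> D y -> `|secant k (f ^~ y) t s| <= g y.
Proof.
move=> ts Dy; have [|u tu ->] := secant_mean_value (k := k) (f := f ^~ y) _ ts.
  by move=> u tu; exact: (dc_derivable fC1).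
exact: (dc_bound fC1).
Qed.

Lemma measurable_secant s k : ball t e s ->
  measurable_fun D (fun y => secant k (f ^~ y) t s).
Proof.
move=> ts; have e0 : 0 < e by case: ts.
rewrite /secant; case: eqP => _; first exact: measurable_partial fC1.
apply: measurable_funM; last exact: measurable_cst.
by apply: measurable_funB; apply: (dc_measurable fC1); exact: ball_path_point.
Qed.

Lemma integrable_secant s k : ball t e s ->
  mu.-integrable D (EFin \o (fun y => secant k (f ^~ y) t s)).
Proof.
move=> ts; apply: le_integrable (dc_integrable fC1) => //.
  by apply/measurable_EFinP; exact: measurable_secant.
move=> y Dy /=; rewrite lee_fin (le_trans (secant_bound k ts Dy))//.
exact: ler_norm.
Qed.

Lemma integrable_partial k : 0 < e ->
  mu.-integrable D (EFin \o (fun y => partial k (f ^~ y) t)).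
Proof.
move=> e0; apply: le_integrable (dc_integrable fC1) => //.
  by apply/measurable_EFinP; exact: measurable_partial fC1.
move=> y Dy /=; rewrite lee_fin.
by apply: le_trans (ler_norm _); apply: (dc_bound fC1) => //; exact: ballxx.
Qed.

Lemma integrable_secantM s k : ball t e s -> mu.-integrable D
  (EFin \o (fun y => secant k (f ^~ y) t s * (s k 0 - t k 0))).
Proof.
move=> ts.
have -> : EFin \o (fun y => secant k (f ^~ y) t s * (s k 0 - t k 0)) =
    (fun y => ((s k 0 - t k 0)%:E * (secant k (f ^~ y) t s)%:E)%E).
  by apply/funext => y /=; rewrite -EFinM mulrC.
by apply: integrableZl => //; exact: integrable_secant.
Qed.

Lemma integrable_increment s : ball t e s ->
  mu.-integrable D (EFin \o (fun y => f s y - f t y)).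
Proof.
move=> ts.
have -> : EFin \o (fun y => f s y - f t y) =
    (fun y => \sum_k (secant k (f ^~ y) t s * (s k 0 - t k 0))%:E)%E.
  by apply/funext => y /=; rewrite (sum_secant (f ^~ y)) sumEFin.
by apply: integrable_sum => // k _; exact: integrable_secantM.
Qed.

Lemma integrable_near s : mu.-integrable D (EFin \o f t) -> ball t e s ->
  mu.-integrable D (EFin \o f s).
Proof.
move=> ift /integrable_increment ifst.
have -> : EFin \o f s =
    ((EFin \o f t) \+ (EFin \o (fun y => f s y - f t y)%R))%E.
  by apply/funext => y /=; rewrite -EFinD addrC subrK.
exact: integrableD.
Qed.

Lemma Rintegral_increment s : mu.-integrable D (EFin \o f t) -> ball t e s ->
  \int[mu]_(y in D) f s y - \int[mu]_(y in D) f t y =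
  \sum_k (\int[mu]_(y in D) secant k (f ^~ y) t s) * (s k 0 - t k 0).
Proof.
move=> ift ts; rewrite -RintegralB//; last exact: integrable_near.
under eq_Rintegral do rewrite (sum_secant (f ^~ _)).
rewrite Rintegral_sum; last by move=> k; exact: integrable_secantM.
by apply: eq_bigr => k _; rewrite RintegralZr//; exact: integrable_secant.
Qed.

(** The analytic core: dominated convergence applies because a secant is a
    value of the partial derivative, bounded by g. *)
Lemma cvg_Rintegral_secant (u : nat -> 'cV[R]_d.+1) k :
  (forall n, ball t e (u n)) -> u @ \oo --> t ->
  (fun n => \int[mu]_(y in D) secant k (f ^~ y) t (u n)) @ \oo -->
  \int[mu]_(y in D) partial k (f ^~ y) t.
Proof.
move=> tu ut; have e0 : 0 < e by case: (tu 0%N).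
have [] := @dominated_convergence _ _ _ mu D mD
  (fun n y => (secant k (f ^~ y) t (u n))%:E)
  (fun y => (partial k (f ^~ y) t)%:E) (EFin \o g).
- by move=> n; apply/measurable_EFinP; exact: measurable_secant.
- by apply/measurable_EFinP; exact: measurable_partial fC1.
- apply: aeW => y Dy; apply: cvg_EFin; first exact: nearW.
  apply/cvgrPdist_lt => /= r r0.
  (* the intermediate point of the mean value theorem depends on y, but it is
     trapped in any ball that contains the other end of the secant *)
  have /cvgrPdist_lt/(_ r r0)/nbhs_ballP[e1 /= e10 near_t] :=
    dc_continuous fC1 (k := k) (ballxx t e0) Dy.
  pose e2 := Num.min e e1.
  have e20 : 0 < e2 by rewrite lt_min e0.
  near=> n; have tun : ball t e2 (u n) by near: n; exact: (cvg_ball ut).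
  have [v tv|v tv ->] := secant_mean_value (k := k) (f := f ^~ y) _ tun.
    by apply: (dc_derivable fC1) => //; apply: le_ball tv; rewrite ge_min lexx.
  by apply: near_t; apply: le_ball tv; rewrite ge_min lexx orbT.
- exact: dc_integrable fC1.
- by apply: aeW => y n Dy /=; rewrite lee_fin; exact: secant_bound.
move=> ip _.
by rewrite -(fineK (integrable_fin_num mD ip)) => /fine_cvgP[_]; exact.
Unshelve. all: by end_near. Qed.

Lemma cvg_partial_Rintegral (u : R^nat) k :
  mu.-integrable D (EFin \o f t) ->
  (forall n, u n != 0) -> (forall n, `|u n| < e) -> u @ \oo --> (0 : R) ->
  (fun n => (u n)^-1 * (\int[mu]_(y in D) f (t + u n *: ei k) y -
                        \int[mu]_(y in D) f t y)) @ \oo -->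
  \int[mu]_(y in D) partial k (f ^~ y) t.
Proof.
move=> ift un0 ue u0.
have tu n : ball t e (t + u n *: ei k) by exact: ball_line.
have := cvg_Rintegral_secant (k := k) tu (cvg_line k u0).
apply: cvg_trans; apply: near_eq_cvg; apply: nearW => n.
rewrite Rintegral_increment// (bigD1 k)//= big1 ?addr0.
  by rewrite !mxE !eqxx mulr1 [t k 0 + _]addrC addrK mulrC mulfK.
by move=> j jk; rewrite !mxE (negbTE jk)/= mulr0 addr0 subrr mulr0.
Qed.

(** At an interior maximum the difference quotients along + u and - u have
    opposite signs.  The coefficients a and b are the weights of the model and
    of the contamination. *)
Lemma Fermat_Rintegral (a b : R) (h : 'cV[R]_d.+1 -> R) k : 0 < e ->
  mu.-integrable D (EFin \o f t) -> derivable h t (ei k) ->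
  (forall s, ball t e s -> a * \int[mu]_(y in D) f s y + b * h s <=
                           a * \int[mu]_(y in D) f t y + b * h t) ->
  a * \int[mu]_(y in D) partial k (f ^~ y) t + b * partial k h t = 0.
Proof.
move=> e0 ift dh tmax; set l := LHS.
pose F s := a * \int[mu]_(y in D) f s y + b * h s.
have quotient (u : R^nat) : (forall n, u n != 0) -> (forall n, `|u n| < e) ->
    u @ \oo --> (0 : R) ->
    (fun n => (u n)^-1 * (F (t + u n *: ei k) - F t)) @ \oo --> l.
  move=> un0 ue u0.
  rewrite (_ : (fun n => _) = (fun n =>
      a * ((u n)^-1 * (\int[mu]_(y in D) f (t + u n *: ei k) y -
                       \int[mu]_(y in D) f t y)) +
      b * ((u n)^-1 * (h (t + u n *: ei k) - h t)))); last first.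
    by apply/funext => n; rewrite /F; ring.
  apply: cvgD; apply: cvgM; try exact: cvg_cst.
    exact: cvg_partial_Rintegral.
  exact: cvg_partial.
have [u [u_gt0 ue u0]] := exists_null_sequence e0.
have FB (v : R) : `|v| < e -> F (t + v *: ei k) - F t <= 0.
  by move=> ve; rewrite subr_le0; apply: tmax; exact: ball_line.
apply/eqP; rewrite eq_le; apply/andP; split.
  have ql := quotient u (fun n => lt0r_neq0 (u_gt0 n)) ue u0.
  rewrite -(cvg_lim _ ql)//; apply: limr_le; first exact: cvgP ql.
  by apply: nearW => n; rewrite pmulr_rle0 ?invr_gt0// FB.
have ql : (fun n => (- u n)^-1 * (F (t + - u n *: ei k) - F t)) @ \oo --> l.
  apply: quotient => [n|n|]; rewrite ?oppr_eq0 ?normrN ?gt_eqF//.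
  by rewrite -oppr0; exact: cvgN.
rewrite -(cvg_lim _ ql)//; apply: limr_ge; first exact: cvgP ql.
by apply: nearW => n; rewrite nmulr_rge0 ?invr_lt0 ?oppr_lt0// FB ?normrN.
Qed.

End Secant.

End UnderIntegral.

(** * Limits of matrices *)

Section MatrixLimits.
Context {R : realType} {I : Type} (F : set_system I) {FF : ProperFilter F}.

Lemma cvg_mx_coord m n (A : I -> 'M[R]_(m, n)) (B : 'M[R]_(m, n)) :
  A @ F --> B <-> forall i j, (fun x => A x i j) @ F --> B i j.
Proof.
split=> [AB i j|AB].
  apply: (@cvg_comp _ _ _ A (fun M : 'M[R]_(m, n) => M i j)); first exact: AB.
  exact: coord_continuous.
apply/cvg_ballP => e e0.
have : \forall x \near F, forall i j, ball (B i j) e (A x i j).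
  apply: filter_forall => i; apply: filter_forall => j.
  exact: (cvg_ball (AB i j)).
by apply: filterS => x ABx; split.
Qed.

Lemma cvg_det n (A : I -> 'M[R]_n) (B : 'M[R]_n) :
  A @ F --> B -> (fun x => \det (A x)) @ F --> \det B.
Proof.
move=> /cvg_mx_coord AB; apply: cvg_big => [|s _]; first exact: add_continuous.
apply: cvgM; first exact: cvg_cst.
by apply: cvg_big => [|i _]; [exact: mul_continuous|exact: AB].
Qed.

Lemma cvg_adjugate n (A : I -> 'M[R]_n) (B : 'M[R]_n) :
  A @ F --> B -> (fun x => \adj (A x)) @ F --> \adj B.
Proof.
move=> /cvg_mx_coord AB; apply/cvg_mx_coord => i j.
under eq_cvg do rewrite mxE.
rewrite mxE; apply: cvgM; first exact: cvg_cst.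
apply: cvg_det; apply/cvg_mx_coord => k l.
under eq_cvg do rewrite !mxE.
by rewrite !mxE; exact: AB.
Qed.

Lemma cvg_mulmx m n p (A : I -> 'M[R]_(m, n)) (B : I -> 'M[R]_(n, p))
    (A0 : 'M[R]_(m, n)) (B0 : 'M[R]_(n, p)) :
  A @ F --> A0 -> B @ F --> B0 -> (fun x => A x *m B x) @ F --> A0 *m B0.
Proof.
move=> /cvg_mx_coord AA0 /cvg_mx_coord BB0; apply/cvg_mx_coord => i j.
under eq_cvg do rewrite mxE.
rewrite mxE; apply: cvg_big => [|k _]; first exact: add_continuous.
by apply: cvgM.
Qed.

(** Cramer's rule expresses w as a rational function of the entries of A and b
    with denominator \det A, which tends to \det A0 != 0. *)
Lemma cvg_linear_system n (A : I -> 'M[R]_n) (w b : I -> 'cV[R]_n)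
    (A0 : 'M[R]_n) (b0 : 'cV[R]_n) :
  A0 \in unitmx -> A @ F --> A0 -> b @ F --> b0 ->
  (\forall x \near F, A x *m w x = b x) -> w @ F --> invmx A0 *m b0.
Proof.
move=> A0u AA0 bb0 Awb.
have dA := cvg_det AA0.
have d0 : \det A0 != 0 by move: A0u; rewrite unitmxE unitfE.
rewrite /invmx A0u -scalemxAl.
have : (fun x => (\det (A x))^-1 *: (\adj (A x) *m b x)) @ F -->
    (\det A0)^-1 *: (\adj A0 *m b0).
  apply/cvg_mx_coord => i j; under eq_cvg do rewrite mxE.
  rewrite mxE; apply: cvgM; first exact: cvgV.
  move: i j; apply/cvg_mx_coord; apply: cvg_mulmx => //; exact: cvg_adjugate.
apply: cvg_trans; apply: near_eq_cvg; near=> x.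
have dx : \det (A x) != 0 by near: x; exact: (cvgr_neq0 _ dA d0).
have -> : b x = A x *m w x by apply/esym; near: x.
by rewrite mulmxA mul_adj_mx mul_scalar_mx scalerA mulVf// scale1r.
Unshelve. all: by end_near. Qed.

End MatrixLimits.

(** * Integrals against densities and contaminated distributions *)

Section Measurability.
Context {disp : measure_display} {X : measurableType disp} {R : realType}.

Lemma measurable_pos (r : X -> R) : measurable_fun setT r ->
  measurable [set y | 0 < r y].
Proof.
move=> mr; have := mr measurableT `]0, +oo[%classic; rewrite setTI.
rewrite (_ : r @^-1` _ = [set y | 0 < r y]); first by apply.
by apply/seteqP; split=> y; rewrite /preimage/= in_itv/= andbT.
Qed.

(** The inverse of a nonnegative function is its power of exponent - 1, with
    the same convention at 0. *)
Lemma measurable_ratio (p q : X -> R) : (forall y, 0 <= q y) ->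
  measurable_fun setT p -> measurable_fun setT q ->
  measurable_fun setT (fun y => p y / q y).
Proof.
move=> q0 mp mq; apply: measurable_funM => //.
rewrite (_ : (fun y => (q y)^-1) = (@powR R ^~ (-1)) \o q); last first.
  by apply/funext => y /=; rewrite powR_inv1.
exact: measurableT_comp.
Qed.

(** Outside ]0, +oo[ the function phi is arbitrary, but r only takes there the
    value 0. *)
Lemma measurable_comp_derivable_pos (phi : R -> R) (r : X -> R) :
  (forall u, 0 < u -> derivable phi u 1) -> (forall y, 0 <= r y) ->
  measurable_fun setT r -> measurable_fun setT (phi \o r).
Proof.
move=> dphi r0 mr.
have mpos := measurable_pos mr.
rewrite -(setUv [set y | 0 < r y]); apply/measurable_funU => //.
  exact: measurableC.
split.
- apply: (measurable_comp (F := `]0, +oo[%classic : set R)) => //.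
  + by move=> _ [y /= ry <-]; rewrite in_itv/= ry.
  + apply: subspace_continuous_measurable_fun => //.
    apply: derivable_within_continuous => u; rewrite in_itv/= andbT.
    exact: dphi.
  + exact: measurable_funTS.
- apply: (eq_measurable_fun (cst (phi 0))); last exact: measurable_cst.
  move=> y; rewrite inE/= => /negP; rewrite -leNgt => ry /=.
  by congr phi; apply/eqP; rewrite eq_le ry r0.
Qed.

End Measurability.

Section Density.
Context {disp : measure_display} {X : measurableType disp} {R : realType}.
Variables (lambda : {measure set X -> \bar R}).
Variables (Q : probability X R) (q : X -> R).
Hypothesis qQ : is_density lambda Q q.

Lemma density_support : Q (~` [set y | 0 < q y]) = 0%E.
Proof.
case: qQ => mq q0 QE; rewrite QE; last exact/measurableC/measurable_pos.
rewrite integral0_eq// => y /= /negP; rewrite -leNgt => qy.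
by congr EFin; apply/eqP; rewrite eq_le qy q0.
Qed.

Import HBNNSimple.

(** Both sides are limits along simple functions increasing to f, by monotone
    convergence, and agree on indicator functions by definition of a density. *)
Lemma ge0_integral_density (f : X -> \bar R) :
  measurable_fun setT f -> (forall y, 0 <= f y)%E ->
  (\int[Q]_y f y = \int[lambda]_y (f y * (q y)%:E))%E.
Proof.
case: qQ => mq q0 QE mf f0.
pose h := nnsfun_approx measurableT mf.
have hf y : (EFin \o h n) y @[n --> \oo] --> f y.
  exact: cvg_nnsfun_approx.
have nd_h y a b : (a <= b)%N -> h a y <= h b y.
  by move=> ab; exact/lefP/nd_nnsfun_approx.
transitivity (limn (fun n => \int[Q]_y (h n y)%:E))%E.
  rewrite -monotone_convergence//.
  - by apply: eq_integral => y _; apply/esym/cvg_lim => //; exact: hf.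
  - by move=> n; apply/measurable_EFinP; exact/measurable_funP.
  - by move=> n y _; rewrite lee_fin.
  - by move=> y _ a b ab; rewrite lee_fin; exact: nd_h.
transitivity (limn (fun n => \int[lambda]_y ((h n y)%:E * (q y)%:E)))%E;
    last first.
  rewrite -monotone_convergence//.
  - apply: eq_integral => y _; apply/cvg_lim => //.
    by apply: cvgeZr => //; exact: hf.
  - by move=> n; apply: emeasurable_funM; apply/measurable_EFinP.
  - by move=> n y _; rewrite mule_ge0// lee_fin.
  - by move=> y _ a b ab; rewrite lee_wpmul2r ?lee_fin//; exact: nd_h.
congr (limn _); apply/funext => n.
have mind r : measurable_fun setT (fun y => (r * \1_(h n @^-1` [set r]) y)%:E).
  by apply/measurable_EFinP; exact: measurable_funM.
have ind0 r y : (0 <= (r * \1_(h n @^-1` [set r]) y)%:E)%E.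
  by rewrite EFinM nnfun_muleindic_ge0.
under [LHS]eq_integral do rewrite fimfunE -fsumEFin//.
rewrite ge0_integral_fsum//.
under [RHS]eq_integral do rewrite fimfunE -fsumEFin// ge0_mule_fsuml//.
rewrite ge0_integral_fsum//; last 2 first.
  - by move=> r; apply: emeasurable_funM => //; exact/measurable_EFinP.
  - by move=> r y _; rewrite mule_ge0// lee_fin.
apply: eq_fsbigr => r rh.
under [LHS]eq_integral do rewrite EFinM.
rewrite integralZl_indic_nnsfun// integral_indic// setIT.
transitivity (r%:E * \int[lambda]_(y in h n @^-1` [set r]) (q y)%:E)%E.
  by congr (_ * _)%E; exact: QE.
have [y0 _ <-] := set_mem rh.
under [RHS]eq_integral do rewrite EFinM -muleA.
rewrite ge0_integralZl//; last 3 first.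
  - by apply: emeasurable_funM; apply/measurable_EFinP.
  - by move=> y _; rewrite mule_ge0 ?lee_fin.
  - by rewrite lee_fin.
congr (_ * _)%E; rewrite [LHS]integral_mkcond; apply: eq_integral => y _.
by rewrite patchE indicE; case: ifPn => _; rewrite ?mul1e ?mul0e.
Qed.

(** Multiplication by q >= 0 commutes with positive and negative parts, and so
    the two integrals have the same positive and the same negative part. *)
Lemma Rintegral_density (f : X -> R) : measurable_fun setT f ->
  \int[Q]_y f y = \int[lambda]_y (f y * q y).
Proof.
case: (qQ) => mq q0 _ mf; congr fine; rewrite integralE [RHS]integralE.
have mfE : measurable_fun setT (EFin \o f) by exact/measurable_EFinP.
congr (_ - _)%E.
  rewrite ge0_integral_density//; last exact: measurable_funepos.
  apply: eq_integral => y _.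
  by rewrite !funeposE /= EFinM maxe_pMl ?mul0e ?lee_fin.
rewrite ge0_integral_density//; last exact: measurable_funeneg.
apply: eq_integral => y _.
by rewrite !funenegE /= -mulNr EFinM maxe_pMl ?mul0e ?lee_fin.
Qed.

End Density.

Section Contamination.
Context {disp : measure_display} {X : measurableType disp} {R : realType}.
Variables (Q : probability X R) (x : X) (e : R).
Hypothesis e01 : 0 <= e <= 1.

Lemma ge0_integral_contamination (f : X -> \bar R) :
  measurable_fun setT f -> (forall y, 0 <= f y)%E ->
  (\int[contamination Q x e]_y f y = (1 - e)%:E * \int[Q]_y f y + e%:E * f x)%E.
Proof.
move=> mf f0; have /andP[e0 e1] := e01.
have e1' : 0 <= 1 - e by rewrite subr_ge0.
transitivity (\int[measure_add (mscale (NngNum e1') Q)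
                                (mscale (NngNum e0) \d_x)]_y f y)%E.
  apply: eq_measure_integral => A _ _.
  by rewrite [RHS]measure_addE /= /contamination e0 e1.
rewrite ge0_integral_measure_add// !ge0_integral_mscale//.
by rewrite integral_dirac// diracT mul1e.
Qed.

Lemma integral_contamination (f : X -> R) :
  Q.-integrable setT (EFin \o f) ->
  (\int[contamination Q x e]_y (f y)%:E =
    ((1 - e) * \int[Q]_y f y + e * f x)%:E)%E.
Proof.
move=> intf; have mf := measurable_int _ intf.
rewrite integralE !ge0_integral_contamination//;
  [|exact: measurable_funeneg|exact: measurable_funepos].
have ip := integrable_fin_num measurableT (integrable_funepos measurableT intf).
have iN := integrable_fin_num measurableT (integrable_funeneg measurableT intf).
have fx : f x = Num.max (f x) 0 - Num.max (- f x) 0.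
  rewrite /Num.max oppr_lt0; case: ltgtP => [f0|f0|->].
  - by rewrite sub0r opprK.
  - by rewrite subr0.
  - by rewrite oppr0 subr0.
move: ip iN; rewrite /Rintegral [in X in _ = X]integralE.
rewrite !funeposE !funenegE -EFinN -!EFin_max {3}fx.
move: (\int[Q]_y _)%E (\int[Q]_y _)%E => [u| |]// [v| |]// _ _.
by congr EFin => /=; ring.
Qed.

End Contamination.

Section ExtendedIntegrals.
Context {disp : measure_display} {X : measurableType disp} {R : realType}.
Variables (mu : {measure set X -> \bar R}) (D : set X).
Hypothesis mD : measurable D.

Lemma integrable_of_fin_num (f : X -> R) : measurable_fun D f ->
  (\int[mu]_(y in D) (f y)%:E \is a fin_num)%E -> mu.-integrable D (EFin \o f).
Proof.
move=> /measurable_EFinP mf; have mp := measurable_funepos mf.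
have mn := measurable_funeneg mf.
rewrite integralE => fin; apply/integrableP; split=> //.
have -> : (\int[mu]_(y in D) `|(EFin \o f) y| =
    \int[mu]_(y in D) ((EFin \o f)^\+ y + (EFin \o f)^\- y))%E.
  apply: eq_integral => y _.
  by rewrite -[LHS]/((abse \o (EFin \o f)) y) fune_abse.
rewrite ge0_integralD//; move: fin.
by move: (integral _ _ _) (integral _ _ _) => [u| |] [v| |]//= _; rewrite ltry.
Qed.

Lemma max0_le_dist (a b : R) : Num.max a 0 <= Num.max b 0 + `|a - b|.
Proof.
have b1 : b <= Num.max b 0 by rewrite le_max lexx.
have b2 : 0 <= Num.max b 0 by rewrite le_max lexx orbT.
have := ler_norm (a - b); have := normr_ge0 (a - b).
by rewrite ge_max => ? ?; apply/andP; split; lra.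
Qed.

(** The positive part of f is at most that of h plus |h - f|, so that h^+ has an
    infinite integral; the negative part of h is at most that of f plus |h - f|,
    so that its integral is finite. *)
Lemma integral_pinfty_increment (f h : X -> R) :
  measurable_fun D f -> measurable_fun D h ->
  mu.-integrable D (EFin \o (fun y => h y - f y)) ->
  (\int[mu]_(y in D) (f y)%:E = +oo -> \int[mu]_(y in D) (h y)%:E = +oo)%E.
Proof.
move=> /measurable_EFinP mf /measurable_EFinP mh intB.
have mfp := measurable_funepos mf; have mfn := measurable_funeneg mf.
have mhp := measurable_funepos mh; have mhn := measurable_funeneg mh.
have /integrableP[mB Boo] := intB.
have mBa : measurable_fun D (fun y => `|(h y - f y)%:E|)%E.
  exact: measurableT_comp.
rewrite integralE [X in _ -> X = _]integralE => foo.
have le_hn : (\int[mu]_(y in D) (EFin \o h)^\- y <=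
    \int[mu]_(y in D) (EFin \o f)^\- y +
    \int[mu]_(y in D) `|(h y - f y)%:E|)%E.
  rewrite -ge0_integralD//; apply: ge0_le_integral => //.
    by apply: emeasurable_funD.
  move=> y _; rewrite !funenegE /= -!EFin_max lee_fin.
  by rewrite -normrN opprD; exact: max0_le_dist.
have le_fp : (\int[mu]_(y in D) (EFin \o f)^\+ y <=
    \int[mu]_(y in D) (EFin \o h)^\+ y +
    \int[mu]_(y in D) `|(h y - f y)%:E|)%E.
  rewrite -ge0_integralD//; apply: ge0_le_integral => //.
    by apply: emeasurable_funD.
  move=> y _; rewrite !funeposE /= -!EFin_max lee_fin.
  by rewrite distrC; exact: max0_le_dist.
have fp0 : (0 <= \int[mu]_(y in D) (EFin \o f)^\+ y)%E by exact: integral_ge0.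
have fn0 : (0 <= \int[mu]_(y in D) (EFin \o f)^\- y)%E by exact: integral_ge0.
have hp0 : (0 <= \int[mu]_(y in D) (EFin \o h)^\+ y)%E by exact: integral_ge0.
have hn0 : (0 <= \int[mu]_(y in D) (EFin \o h)^\- y)%E by exact: integral_ge0.
have B0 : (0 <= \int[mu]_(y in D) `|(h y - f y)%:E|)%E by exact: integral_ge0.
move: foo Boo le_hn le_fp fp0 fn0 hp0 hn0 B0 => /=.
move: (\int[mu]_(y in D) (EFin \o f)^\+ y)%E.
move: (\int[mu]_(y in D) (EFin \o f)^\- y)%E.
move: (\int[mu]_(y in D) (EFin \o h)^\+ y)%E.
move: (\int[mu]_(y in D) (EFin \o h)^\- y)%E.
move: (\int[mu]_(y in D) `|(h y - f y)%:E|)%E.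
by move=> [b| |] [hn| |] [hp| |] [fn| |] [fp| |].
Qed.

End ExtendedIntegrals.

(** * The influence function of a maximizer *)

Section MaximumEstimator.
Context {disp : measure_display} {X : measurableType disp} {R : realType}.
Context {d : nat}.
Variables (Theta : set 'cV[R]_d.+1) (m : 'cV[R]_d.+1 -> X -> R).
Variables (Q : probability X R) (S : set X) (theta0 : 'cV[R]_d.+1).
Hypothesis mS : measurable S.
Hypothesis QS : Q (~` S) = 0%E.
Hypothesis theta0_interior : Theta° theta0.
Hypothesis m_measurable : forall theta, Theta theta ->
  measurable_fun setT (m theta).
Hypothesis argsup_theta0 : argsup Theta m Q = [set theta0].
Hypothesis m_C2 : forall y, S y -> C2_on Theta° (m ^~ y).
Variable g : X -> R.
Hypothesis g_integrable : Q.-integrable setT (EFin \o g).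
Hypothesis m_dominated : \forall theta \near theta0, forall y, S y ->
  (forall i, `|gradient (m ^~ y) theta i 0| <= g y) /\
  (forall i j, `|hessian (m ^~ y) theta i j| <= g y).

Let dm i theta y := partial i (m ^~ y) theta.

Lemma integral_full (f : X -> R) : measurable_fun setT f ->
  (\int[Q]_y (f y)%:E = \int[Q]_(y in S) (f y)%:E)%E.
Proof.
move=> mf; rewrite [RHS]integral_mkcond.
have mfE : measurable_fun setT (EFin \o f) by exact/measurable_EFinP.
apply: ae_eq_integral => //.
  by apply/(measurable_restrictT _ mS); exact: measurable_funTS.
exists (~` S); split=> //; first exact: measurableC.
move=> y /= /not_implyP[_ fy] Sy; apply: fy.
by rewrite /patch mem_set.
Qed.

Lemma integrable_full (f : X -> R) : measurable_fun setT f ->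
  Q.-integrable S (EFin \o f) -> Q.-integrable setT (EFin \o f).
Proof.
move=> mf intf; apply/(negligible_integrable (N := ~` S)) => //.
- exact: measurableC.
- exact/measurable_EFinP.
- by rewrite setTD setCK.
Qed.

Lemma dominated_C1_criterion : exists2 e, 0 < e &
  [/\ ball theta0 e `<=` Theta°, dominated_C1 Q S m theta0 e g &
      forall i, dominated_C1 Q S (dm i) theta0 e g].
Proof.
have nTheta : nbhs theta0 Theta°.
  by apply: open_nbhs_nbhs; split=> //; exact: open_interior.
have : nbhs theta0 (Theta° `&` _) :=
  @filterI _ _ (nbhs_filter theta0) _ _ nTheta m_dominated.
move=> /nbhs_ballP[e /= e0 be].
have gS : Q.-integrable S (EFin \o g) by exact: integrableS g_integrable.
have inTheta : ball theta0 e `<=` Theta° by move=> u /be[].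
have mC1 : dominated_C1 Q S m theta0 e g.
  split=> //.
  - move=> u /inTheta uT; apply: (measurable_funS measurableT) => //.
    by apply: m_measurable; exact: interior_subset.
  - by move=> u y k /inTheta uT Sy; have [_ /(_ k)[]] := m_C2 Sy uT.
  - by move=> u y k /inTheta uT Sy; have [_ /(_ k)[]] := m_C2 Sy uT.
  - move=> u y k /be[_ /(_ y)] + Sy => /(_ Sy)[/(_ k)].
    by rewrite mxE.
exists e => //; split=> // i; split=> //.
- move=> u eu; have [e' e'0 [mC1u _]] := dominated_C1_sub mC1 eu.
  exact: measurable_partial mC1u.
- by move=> u y k /inTheta uT Sy; have [_ _ /(_ i k)[]] := m_C2 Sy uT.
- by move=> u y k /inTheta uT Sy; have [_ _ /(_ i k)[]] := m_C2 Sy uT.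
- move=> u y k /be[_ /(_ y)] + Sy => /(_ Sy)[_ /(_ i k)].
  by rewrite mxE.
Qed.

Lemma argsup_uniq theta : Theta theta ->
  criterion m Q theta = criterion m Q theta0 -> theta = theta0.
Proof.
move=> Tt E; have [_ E0] : argsup Theta m Q theta0 by rewrite argsup_theta0.
by have : [set theta0] theta by rewrite -argsup_theta0; split=> //; rewrite E.
Qed.

Lemma le_criterion theta : Theta theta ->
  (criterion m Q theta <= criterion m Q theta0)%E.
Proof.
have [_ ->] : argsup Theta m Q theta0 by rewrite argsup_theta0.
by move=> Tt; apply: ereal_sup_ubound; exists theta.
Qed.

(** An infinite maximal value is shared by the neighbours of theta0, because
    increments of m are integrable; this contradicts the uniqueness of the
    maximizer.  The value -oo is excluded as well, as all points would then be
    maximizers. *)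
Lemma integrable_criterion0 : Q.-integrable S (EFin \o m theta0).
Proof.
have [e e0 [inTheta mC1 _]] := dominated_C1_criterion.
have T0 : Theta theta0 by exact: interior_subset.
apply: integrable_of_fin_num => //.
  by apply: (measurable_funS measurableT) => //; exact: m_measurable.
rewrite -integral_full; last exact: m_measurable.
pose theta1 := theta0 + (e / 2) *: ei 0.
have b1 : ball theta0 e theta1.
  by apply: ball_line; rewrite gtr0_norm ?divr_gt0//; lra.
have T1 : Theta theta1 by apply: interior_subset; exact: inTheta.
have theta10 : theta1 <> theta0.
  move=> /colP/(_ 0); rewrite !mxE eqxx/= mulr1 => /eqP.
  rewrite -subr_eq0 addrAC subrr add0r.
  by apply/negP; rewrite gt_eqF// divr_gt0.
have := le_criterion T1; have := argsup_uniq T1.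
rewrite -/(criterion m Q theta0).
case E0 : (criterion m Q theta0) => [r| |] //.
  have -> : criterion m Q theta1 = +oo%E; last by move=> /(_ erefl).
  move: E0; rewrite /criterion !integral_full; [|exact: m_measurable..].
  apply: integral_pinfty_increment => //.
  - by apply: (measurable_funS measurableT) => //; exact: m_measurable.
  - by apply: (measurable_funS measurableT) => //; exact: m_measurable.
  - exact: (integrable_increment mS mC1 b1).
by rewrite leeNy_eq => + /eqP E1 => /(_ E1).
Qed.

Lemma integrable_criterion theta e : dominated_C1 Q S m theta0 e g ->
  ball theta0 e theta -> Q.-integrable S (EFin \o m theta).
Proof.
move=> mC1 bt.
exact: (integrable_near mS mC1 integrable_criterion0).
Qed.

Lemma Rintegral_score_eq0 i : \int[Q]_(y in S) dm i theta0 y = 0.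
Proof.
have [e e0 [inTheta mC1 _]] := dominated_C1_criterion.
rewrite -[LHS]mul1r -[LHS]addr0.
rewrite -[X in _ + X](mul0r (partial i (cst 0) theta0)).
apply: (Fermat_Rintegral mS mC1 e0 integrable_criterion0) => [|s bs].
  exact: derivable_cst.
rewrite !mul0r !addr0 !mul1r.
have Ts : Theta s by apply: interior_subset; exact: inTheta.
have T0 : Theta theta0 by exact: interior_subset.
have := le_criterion Ts.
rewrite /criterion !integral_full; [|exact: m_measurable..].
apply: fine_le; apply: integrable_fin_num => //.
  exact: integrable_criterion mC1 bs.
exact: integrable_criterion0.
Qed.

Section Contaminated.
Variable x : X.
Hypothesis Sx : S x.

Lemma criterion_contamination (eps e : R) theta :
  0 <= eps <= 1 -> dominated_C1 Q S m theta0 e g -> Theta theta ->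
  ball theta0 e theta ->
  criterion m (contamination Q x eps) theta =
  ((1 - eps) * \int[Q]_(y in S) m theta y + eps * m theta x)%:E.
Proof.
move=> eps01 mC1 Tt bt; have mt := m_measurable Tt.
rewrite /criterion integral_contamination//.
  by rewrite /Rintegral integral_full.
by apply: integrable_full => //; exact: integrable_criterion mC1 bt.
Qed.

Lemma contaminated_score_eq0 (eps e : R) theta i :
  0 <= eps <= 1 -> dominated_C1 Q S m theta0 e g ->
  ball theta0 e `<=` Theta° ->
  ball theta0 e theta -> argsup Theta m (contamination Q x eps) theta ->
  (1 - eps) * \int[Q]_(y in S) dm i theta y + eps * dm i theta x = 0.
Proof.
move=> eps01 mC1 inTheta bt [Tt supt].
have [e' e'0 [mC1t be']] := dominated_C1_sub mC1 bt.
apply: (Fermat_Rintegral mS mC1t (h := m ^~ x) e'0).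
- exact: integrable_criterion mC1 bt.
- by apply: (dc_derivable mC1).
- move=> s /be' bs.
  have Ts : Theta s by apply: interior_subset; exact: inTheta.
  rewrite -lee_fin -!(@criterion_contamination _ e)//.
  by rewrite supt; apply: ereal_sup_ubound; exists s.
Qed.

Variable T : probability X R -> 'cV[R]_d.+1.
Hypothesis T_argsup : argsup_functional Theta m T.
Hypothesis T_defined : \forall e \near 0^'+,
  argsup Theta m (contamination Q x e) !=set0.
Hypothesis T_continuous : T (contamination Q x e) @[e --> 0^'+] --> T Q.
Let J := integral_mx Q (fun y => hessian (m ^~ y) theta0).
Hypothesis J_integrable :
  integrable_mx Q (fun y => hessian (m ^~ y) theta0).
Hypothesis J_invertible : J \in unitmx.

Lemma functional_theta0 : T Q = theta0.
Proof. by have := @T_argsup Q; rewrite argsup_theta0; apply; exists theta0. Qed.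

Lemma integral_hessian i k :
  J i k = \int[Q]_(y in S) partial k (dm i ^~ y) theta0.
Proof.
rewrite mxE /Rintegral integral_full.
  by congr fine; apply: eq_integral => y _; rewrite mxE.
exact/measurable_EFinP/(measurable_int _ (J_integrable i k)).
Qed.

(** The maximizers theta n solve the linear system A n *m w n = b n, where
    w n is the quotient whose limit is sought: the score equation at theta n,
    minus the one at theta0, is expanded along the secants of the gradient. *)
Lemma influence_function_argsup :
  is_influence_function T Q x (invmx J *m - gradient (m ^~ x) theta0).
Proof.
have [e e0 [inTheta mC1 dmC1]] := dominated_C1_criterion.
rewrite /is_influence_function functional_theta0.
apply/cvg_mx_coord => i j; apply/cvg_at_rightP => u [u_gt0 u0].
move: i j; apply/cvg_mx_coord.
have u_right : u @ \oo --> (0 : R)^'+.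
  move=> B [r /= r0 rB]; change (\forall n \near \oo, B (u n)).
  move/cvgrPdist_lt : u0 => /(_ r r0); apply: filterS => n un.
  by apply: rB => //; exact: u_gt0.
have T_def : \forall n \near \oo,
    argsup Theta m (contamination Q x (u n)) !=set0.
  exact: u_right _ T_defined.
pose theta n := T (contamination Q x (u n)).
have theta_cvg : theta @ \oo --> theta0.
  by rewrite -functional_theta0; exact: cvg_comp u_right T_continuous.
have near_ball : \forall n \near \oo, ball theta0 e (theta n).
  exact: (cvg_ball theta_cvg).
(* the secants are only controlled in the ball, hence this truncation *)
pose theta' n := if `[< ball theta0 e (theta n) >] then theta n else theta0.
have theta'_ball n : ball theta0 e (theta' n).
  by rewrite /theta'; case: asboolP => // _; exact: ballxx.
have theta'_cvg : theta' @ \oo --> theta0.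
  apply: cvg_trans theta_cvg; apply: near_eq_cvg.
  by apply: filterS near_ball => n bn; rewrite /theta' asboolT.
pose A n : 'M[R]_d.+1 :=
  \matrix_(i, k) \int[Q]_(y in S) secant k (dm i ^~ y) theta0 (theta' n).
have AJ : A @ \oo --> J.
  apply/cvg_mx_coord => i k; under eq_cvg do rewrite mxE.
  rewrite integral_hessian.
  exact: (cvg_Rintegral_secant mS (dmC1 i) theta'_ball theta'_cvg).
pose b n := - ((1 - u n)^-1 *: gradient (m ^~ x) (theta n)).
have bb : b @ \oo --> - gradient (m ^~ x) theta0.
  apply: cvgN; apply/cvg_mx_coord => i j; under eq_cvg do rewrite !mxE.
  have -> : gradient (m ^~ x) theta0 i j = (1 - 0)^-1 * dm i theta0 x.
    by rewrite mxE subr0 invr1 mul1r.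
  apply: cvgM.
    apply: cvgV; first by rewrite subr0 oner_neq0.
    by apply: cvgB => //; exact: cvg_cst.
  have [_ /(_ i)[_ cont] _] := m_C2 Sx theta0_interior.
  exact: cvg_comp theta_cvg cont.
apply: (cvg_linear_system J_invertible AJ bb).
near=> n.
have bn : ball theta0 e (theta n) by near: n.
have un1 : u n < 1 by near: n; exact: (cvgr_lt _ u0).
have un0 : u n != 0 by rewrite gt_eqF.
have un1' : 1 - u n != 0 by rewrite subr_eq0 eq_sym lt_eqF.
have un01 : 0 <= u n <= 1 by rewrite !ltW.
have An : argsup Theta m (contamination Q x (u n)) (theta n).
  by apply: T_argsup; near: n.
have theta'E : theta' n = theta n by rewrite /theta' asboolT.
apply/colP => i.
have AG : \sum_k A n i k * (theta n k 0 - theta0 k 0) =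
    \int[Q]_(y in S) dm i (theta n) y.
  rewrite -[RHS]subr0 -[X in _ - X](Rintegral_score_eq0 i).
  rewrite (Rintegral_increment mS (dmC1 i) (integrable_partial mS mC1 i e0) bn).
  by apply: eq_bigr => k _; rewrite mxE theta'E.
have foc := contaminated_score_eq0 i un01 mC1 inTheta bn An.
rewrite -AG in foc; rewrite [LHS]mxE (eq_bigr (fun k =>
  (u n)^-1 * (A n i k * (theta n k 0 - theta0 k 0)))); last first.
  by move=> k _; rewrite !mxE -/(theta n); ring.
rewrite -mulr_sumr !mxE; move: foc.
move: (\sum_k _) => s /eqP; rewrite addr_eq0 => /eqP E.
rewrite -/(dm i (theta n) x).
have -> : dm i (theta n) x = - ((1 - u n) * s / u n) by rewrite E; field.
by field; rewrite un0.
Unshelve. all: by end_near. Qed.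

End Contaminated.

End MaximumEstimator.

(** * The dual criterion *)

Section DualCriterion.
Context {R : realType} {d : nat}.

(** The derivative of phi'(r) r - phi(r) with respect to r is phi''(r) r, the
    terms in phi'(r) cancelling, and r = a / p has derivative - a / p^2 pdot. *)
Lemma is_derive_dual_integrand (phi : R -> R) (p : 'cV[R]_d.+1 -> R)
    (a : R) t v :
  divergence_generator phi -> 0 < a -> 0 < p t -> derivable p t v ->
  is_derive t v
    (fun s => derive1 phi (a / p s) * (a / p s) - phi (a / p s))
    (- (derive1 (derive1 phi) (a / p t) * (a ^+ 2 / p t ^+ 3) * 'D_v p t)).
Proof.
move=> hphi a0 pt0 dp.
have t0 : t + (0 : R) *: v = t by rewrite scale0r addr0.
rewrite -{1}t0; apply/is_derive_line.
have pE : p (t + (0 : R) *: v) = p t by rewrite t0.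
have dline : is_derive (0 : R) 1 (fun h : R => p (t + h *: v)) ('D_v p t).
  by apply/is_derive_line; rewrite t0; split.
have r0 : 0 < a / p (t + (0 : R) *: v) by rewrite pE divr_gt0.
have pn0 : p (t + (0 : R) *: v) != 0 by rewrite pE gt_eqF.
pose r (h : R) := a * (p (t + h *: v))^-1.
have dr : is_derive (0 : R) 1 r (- (a / p t ^+ 2 * 'D_v p t)).
  have := is_deriveZ a (is_deriveV pn0 dline); move=> /is_derive_eq; apply.
  by rewrite pE /GRing.scale/=; field; rewrite gt_eqF.
have dphi : is_derive (r 0) 1 phi (derive1 phi (r 0)).
  by rewrite derive1E; apply/derivableP; exact: dg_derivable.
have dphi' :
    is_derive (r 0) 1 (derive1 phi) (derive1 (derive1 phi) (r 0)).
  rewrite [derive1 (derive1 _) _]derive1E.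
  by apply/derivableP; exact: dg_derivable2.
have := is_deriveB (is_deriveM (is_derive1_comp dphi' dr) dr)
  (is_derive1_comp dphi dr).
have r00 : r 0 = a / p t by rewrite /r pE.
move=> /is_derive_eq; apply; rewrite r00 /GRing.scale/= r00.
by field; rewrite gt_eqF.
Qed.

Context {disp : measure_display} {X : measurableType disp}.
Variables (phi : R -> R) (P : 'cV[R]_d.+1 -> probability X R).
Variables (p : 'cV[R]_d.+1 -> X -> R) (alpha : 'cV[R]_d.+1).
Hypothesis hphi : divergence_generator phi.
Hypothesis mpa : measurable_fun setT (p alpha).
Hypothesis pa_ge0 : forall y, 0 <= p alpha y.

Let m theta := dual_m phi P p theta alpha.

Lemma measurable_dual_m theta : measurable_fun setT (p theta) ->
  (forall y, 0 <= p theta y) -> measurable_fun setT (m theta).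
Proof.
move=> mpt pt_ge0.
have r_ge0 y : 0 <= p alpha y / p theta y by rewrite divr_ge0.
have mr := measurable_ratio pt_ge0 mpa mpt.
have mphi := measurable_comp_derivable_pos (dg_derivable hphi) r_ge0 mr.
have mphi' := measurable_comp_derivable_pos (dg_derivable2 hphi) r_ge0 mr.
apply: measurable_funB; first exact: measurable_cst.
by apply: measurable_funB => //; exact: measurable_funM.
Qed.

(** The part of the score of m that depends on the observation: the derivative
    of phi (r) - phi'(r) r, where r = p_alpha / p_theta. *)
Definition ratio_score i theta y :=
  derive1 (derive1 phi) (p alpha y / p theta y)
  * (p alpha y ^+ 2 / p theta y ^+ 3) * partial i (p ^~ y) theta.

(** Both sides are the derivative of the term of m that does not depend on the
    observation: it exists because m and the ratio term are derivable. *)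
Lemma partial_dual_m i theta y z :
  (forall w, derivable (p ^~ w) theta (ei i)) ->
  (forall w, 0 < p theta w -> 0 < p alpha w) ->
  (forall w, 0 < p theta w -> derivable (m ^~ w) theta (ei i)) ->
  0 < p theta y -> 0 < p theta z ->
  partial i (m ^~ y) theta - ratio_score i theta y =
  partial i (m ^~ z) theta - ratio_score i theta z.
Proof.
move=> dp supp dm.
suff c_derive w : 0 < p theta w -> is_derive theta (ei i)
    (fun t => \int[P alpha]_u (derive1 phi (p alpha u / p t u)))
    (partial i (m ^~ w) theta - ratio_score i theta w).
  by move=> /c_derive[_ <-] /c_derive[_ <-].
move=> ptw.
have := is_deriveD (derivableP (dm w ptw))
  (is_derive_dual_integrand hphi (supp w ptw) ptw (dp w)).
congr is_derive.
by apply/funext => t /=; rewrite /m /dual_m subrK.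
Qed.

End DualCriterion.

Unset Implicit Arguments.
Set Strict Implicit.
Set Printing Implicit Defensive.

Theorem proposition1 (R : realType) (disp : measure_display)
    (X : measurableType disp) (d : nat)
    (lambda : {sigma_finite_measure set X -> \bar R})
    (phi : R -> R) (Theta : set 'cV[R]_d.+1)
    (P : 'cV[R]_d.+1 -> probability X R) (p : 'cV[R]_d.+1 -> X -> R)
    (theta0 alpha : 'cV[R]_d.+1)
    (T : probability X R -> 'cV[R]_d.+1) (x : X)
    (m := fun theta => dual_m phi P p theta alpha)
    (pdot := fun theta y => gradient (p ^~ y) theta)
    (* the divergence and the model *)
    (hphi : divergence_generator phi)
    (hid : identifiable Theta P)
    (hp : forall theta, Theta theta -> is_density lambda (P theta) (p theta))
    (hsupp : forall theta y, Theta theta -> 0 < p theta y <-> 0 < p theta0 y)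
    (htheta0 : Theta° theta0)
    (halpha : Theta alpha)
    (hpdot : forall theta y, Theta° theta -> differentiable (p ^~ y) theta)
    (* the dual representation *)
    (hm : forall theta, Theta theta ->
       (P alpha).-integrable setT
         (fun y => (derive1 phi (p alpha y / p theta y))%:E))
    (hdual : phi_divergence phi P p alpha theta0 =
       ereal_sup [set criterion m (P theta0) theta | theta in Theta])
    (hmax : argsup Theta m (P theta0) = [set theta0])
    (* regularity of m *)
    (hC2 : forall y, 0 < p theta0 y -> C2_on Theta° (m ^~ y))
    (hHint : integrable_mx (P theta0) (fun y => hessian (m ^~ y) theta0))
    (hHinv : integral_mx (P theta0) (fun y => hessian (m ^~ y) theta0)
               \in unitmx)
    (hdom : exists2 g : X -> R, (P theta0).-integrable setT (EFin \o g) &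
       \forall theta \near theta0, forall y, 0 < p theta0 y ->
         (forall i, `|gradient (m ^~ y) theta i 0| <= g y) /\
         (forall i j, `|hessian (m ^~ y) theta i j| <= g y))
    (* the functional, defined and continuous along the contamination path *)
    (hT : argsup_functional Theta m T)
    (hTdef : \forall e \near 0^'+,
       argsup Theta m (contamination (P theta0) x e) !=set0)
    (hTcont : T (contamination (P theta0) x e) @[e --> 0^'+] -->
       T (P theta0))
    (hx : 0 < p theta0 x) :
  is_influence_function T (P theta0) x
    (invmx (integral_mx (P theta0) (fun y => hessian (m ^~ y) theta0)) *m
     (integral_mx (P alpha) (fun y =>
        (derive1 (derive1 phi) (p alpha y / p theta0 y)
           * (p alpha y / p theta0 y ^+ 2)) *: pdot theta0 y)
      - (derive1 (derive1 phi) (p alpha x / p theta0 x)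
           * (p alpha x ^+ 2 / p theta0 x ^+ 3)) *: pdot theta0 x)).
Proof.
have T0 : Theta theta0 by exact: interior_subset.
have [mp0 p0_ge0 _] := hp _ T0; have [mpa pa_ge0 _] := hp _ halpha.
pose S := [set y | 0 < p theta0 y].
have mS : measurable S by exact: measurable_pos.
have p0_out y : ~ S y -> p theta0 y = 0.
  by move=> /negP; rewrite -leNgt => y0; apply/eqP; rewrite eq_le y0 p0_ge0.
have pa_pos y : S y -> 0 < p alpha y by move=> Sy; exact/(hsupp _ _ halpha).
have pa_out y : ~ S y -> p alpha y = 0.
  move=> Sy; apply/eqP; rewrite eq_le pa_ge0 andbT leNgt; apply/negP.
  by move=> /(hsupp _ _ halpha).
have P0S : P theta0 (~` S) = 0%E by exact: density_support (hp _ T0).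
have m_measurable theta : Theta theta -> measurable_fun setT (m theta).
  by move=> /hp[mpt pt_ge0 _]; exact: measurable_dual_m.
have [g ig dom] := hdom.
have [e e0 [_ mC1 _]] :=
  dominated_C1_criterion mS htheta0 m_measurable hC2 ig dom.
suff E : - gradient (m ^~ x) theta0 = integral_mx (P alpha) (fun y =>
        (derive1 (derive1 phi) (p alpha y / p theta0 y)
           * (p alpha y / p theta0 y ^+ 2)) *: pdot theta0 y)
      - (derive1 (derive1 phi) (p alpha x / p theta0 x)
           * (p alpha x ^+ 2 / p theta0 x ^+ 3)) *: pdot theta0 x.
  rewrite -E; exact: (influence_function_argsup mS P0S htheta0 m_measurable
    hmax hC2 ig dom hx hT hTdef hTcont hHint hHinv).
apply/colP => i; rewrite !mxE.
pose psi := ratio_score phi p alpha i theta0.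
pose dm y := partial i (m ^~ y) theta0.
rewrite -/(ratio_score phi p alpha i theta0 x) -/(psi x) -/(dm x).
pose dc := dm x - psi x.
have dmE y : S y -> dm y - dc = psi y.
  move=> Sy; rewrite /dc -(@partial_dual_m _ _ _ _ _ P _ _ hphi i theta0 y x)//.
  - by rewrite subKr.
  - by move=> w; apply: diff_derivable; exact: hpdot.
  - by move=> w Sw; have [_ /(_ i)[]] := hC2 _ Sw _ htheta0.
have int_dm : (P theta0).-integrable S (EFin \o dm).
  exact: (integrable_partial mS mC1 i e0).
have int_dc : (P theta0).-integrable S (EFin \o (fun=> dc)).
  apply: (integrableS measurableT) => //.
  exact: finite_measure_integrable_cst.
(* this is psi on the support; it is measurable because the partial
   derivatives of m are limits of difference quotients *)
pose Psi := (fun y => dm y - dc) \_ S.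
have mPsi : measurable_fun setT Psi.
  apply/(measurable_restrictT _ mS).
  apply: measurable_funB; last exact: measurable_cst.
  exact/measurable_EFinP/(measurable_int _ int_dm).
have int_Psi : \int[P theta0]_y Psi y = - dc.
  rewrite -Rintegral_mkcond RintegralB//.
  rewrite (Rintegral_score_eq0 mS P0S htheta0 m_measurable hmax hC2 ig dom).
  rewrite sub0r Rintegral_cst//.
  have /(congr1 fine) PS : P theta0 S = 1%E.
    rewrite -(setCK S) probability_setC; last exact: measurableC.
    by rewrite P0S sube0.
  by rewrite -[in RHS](mulr1 dc); congr (- (_ * _)); exact: PS.
pose F y := derive1 (derive1 phi) (p alpha y / p theta0 y)
  * (p alpha y / p theta0 y ^+ 2) * partial i (p ^~ y) theta0.
have FE y : F y = Psi y * (p theta0 y / p alpha y).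
  rewrite /F /Psi patchE; case: ifPn => [/set_mem Sy|/negP Sy].
    have pay := pa_pos y Sy.
    by rewrite dmE// /psi /ratio_score; field; rewrite !gt_eqF.
  by rewrite mul0r pa_out ?mul0r ?mulr0 ?mul0r// => /mem_set.
have mF : measurable_fun setT F.
  rewrite (_ : F = (fun y => Psi y * (p theta0 y / p alpha y))).
    by apply: measurable_funM => //; exact: measurable_ratio.
  exact/funext.
suff EF : \int[P alpha]_y F y = - dc.
  rewrite [X in _ = X - _](_ : _ = - dc); first by rewrite /dc; ring.
  by rewrite -EF; apply: eq_Rintegral => y _; rewrite !mxE.
rewrite (Rintegral_density (hp _ halpha))// -int_Psi.
rewrite (Rintegral_density (hp _ T0))//.
apply: eq_Rintegral => y _; rewrite FE.
have [Sy|Sy] := pselect (S y).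
  by have pay := pa_pos y Sy; field; rewrite gt_eqF.
by rewrite pa_out// p0_out// !mulr0.
Qed.
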